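(* Consider the system model described in the context, with marginal SINR distribution function $F$ and density $f$. Suppose $f$ is bounded in a neighbourhood of $0$, is differentiable on $(0,\infty)$, and satisfies $$f'\big(F^{-1}(x)\big) \le -\frac{f\big(F^{-1}(x)\big)}{1+F^{-1}(x)} \quad\text{for all } x \in [0,1)$$ (with $F^{-1}(0)=0$). Then the ergodic sum rate $R(\vec p)$, viewed as a function of the vector of feedback probabilities $\vec p=(p_1,\dots,p_n)\in[0,1]^n$, is Schur-concave on $[0,1]^n$.
   Context: System model: there are $n\ge 2$ users and $M\ge1$ beams. The SINR of user $i$ on beam $m$ is $\gamma_{i,m} = |X_{i,m}|^2 / \big(\tfrac1\rho + \sum_{k\ne m}|X_{i,k}|^2\big)$ with $\rho>0$. The vectors $(\gamma_{i,1},\dots,\gamma_{i,M})$, $i=1,\dots,n$, are i.i.d. across users; within a user the $\gamma_{i,m}$ are identically distributed (possibly dependent) with common marginal distribution function $F$, which is continuous with density $f$ whose support is $[0,\infty)$. Each user $i$ has a threshold $\tau_i\in[0,\infty]$ and reports, for each beam $m$, the truncated SINR $\bar\gamma_{i,m} = \gamma_{i,m}\mathbf 1\{\gamma_{i,m}\ge\tau_i\}$. The base station schedules on each beam the user with the largest reported SINR, giving ergodic sum rate $R(\vec\tau) = \mathbb{E}\big[\sum_{m=1}^M \log(1+\max_{1\le i\le n}\bar\gamma_{i,m})\big]$. The feedback probability of user $i$ is $p_i = \Pr\{\gamma_{i,1}\ge\tau_i\} = 1-F(\tau_i)$; since $\tau_i = F^{-1}(1-p_i)$ (with $F^{-1}(1)=+\infty$),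 $R$ may be regarded as a function $R(\vec p)$ of $\vec p\in[0,1]^n$. Majorization: for $\vec x,\vec y\in\mathbb R^n$ with decreasingly ordered coordinates $x_{[1]}\ge\dots\ge x_{[n]}$, $\vec x$ majorizes $\vec y$ if $\sum_{i=1}^j x_{[i]}\ge\sum_{i=1}^j y_{[i]}$ for $j=1,\dots,n-1$ and $\sum_{i=1}^n x_{[i]} = \sum_{i=1}^n y_{[i]}$. A function $\varphi$ is Schur-concave if $\vec x$ majorizing $\vec y$ implies $\varphi(\vec x)\le\varphi(\vec y)$. *)

(* Defs.v *)
From HB Require Import structures.
From mathcomp Require Import all_boot all_order all_algebra.
From mathcomp Require Import all_classical all_reals all_analysis.
Set Implicit Arguments. Unset Strict Implicit. Unset Printing Implicit Defensive.
Import Order.TTheory GRing.Theory Num.Theory.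
Import numFieldNormedType.Exports.
Local Open Scope classical_set_scope.
Local Open Scope ring_scope.

Section Defs.
Context {R : realType}.

Definition dec_sorted (n : nat) (x : 'I_n -> R) : seq R :=
  sort (fun a b : R => b <= a) [seq x i | i <- enum 'I_n].

Definition majorizes (n : nat) (x y : 'I_n -> R) : Prop :=
  (forall j : nat, (1 <= j <= n.-1)%N ->
     \sum_(a <- take j (dec_sorted y)) a <= \sum_(a <- take j (dec_sorted x)) a)
  /\ \sum_(a <- dec_sorted x) a = \sum_(a <- dec_sorted y) a.

Definition schur_concave_on (n : nat) (D : set ('I_n -> R))
  (phi : ('I_n -> R) -> \bar R) : Prop :=
  forall x y, D x -> D y -> majorizes x y -> (phi x <= phi y)%E.

Definition unit_cube (n : nat) : set ('I_n -> R) :=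
  [set p | forall i, 0 <= p i <= 1].

(* Quantile restricted to [0,oo): F^{-1}(x) = inf {t >= 0 | F t >= x},
   so that F^{-1}(0) = 0 and F^{-1}(1) = +oo when F < 1 everywhere. *)
Definition Finv (F : R -> R) (x : R) : \bar R :=
  ereal_inf [set t%:E | t in [set t : R | 0 <= t /\ x <= F t]].

(* SINR of user i on beam m; G i k = |X_{i,k}|^2 *)
Definition sinr (n M : nat) (rho : R) (G : 'I_n -> 'I_M -> R)
  (i : 'I_n) (m : 'I_M) : R :=
  G i m / (rho^-1 + \sum_(k < M | k != m) G i k).

Definition trunc_sinr (g : R) (tau : \bar R) : R :=
  if (tau <= g%:E)%E then g else 0.

Definition thresholds (n : nat) (F : R -> R) (p : 'I_n -> R) : 'I_n -> \bar R :=
  fun i => Finv F (1 - p i).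

Definition sum_rate {d : measure_display} {T : measurableType d}
  (P : probability T R) (n M : nat) (gam : 'I_n -> 'I_M -> T -> R)
  (F : R -> R) (p : 'I_n -> R) : \bar R :=
  (\int[P]_w (\sum_(m < M)
      ln (1 + \big[Order.max/0]_(i < n)
                 trunc_sinr (gam i m w) (thresholds F p i)))%:E)%E.

Definition users_independent {d : measure_display} {T : measurableType d}
  (P : probability T R) (n M : nat) (gam : 'I_n -> 'I_M -> T -> R) : Prop :=
  forall A : 'I_n -> 'I_M -> set R, (forall i m, measurable (A i m)) ->
    P (\big[setI/setT]_(i < n) \big[setI/setT]_(m < M) (gam i m @^-1` A i m))
    = (\prod_(i < n) P (\big[setI/setT]_(m < M) (gam i m @^-1` A i m)))%E.

Definition users_ident_distr {d : measure_display} {T : measurableType d}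
  (P : probability T R) (n M : nat) (gam : 'I_n -> 'I_M -> T -> R) : Prop :=
  forall (A : 'I_M -> set R) (i j : 'I_n), (forall m, measurable (A m)) ->
    P (\big[setI/setT]_(m < M) (gam i m @^-1` A m))
    = P (\big[setI/setT]_(m < M) (gam j m @^-1` A m)).

End Defs.

(* Main.v *)
(* Write [q_i = 1 - p_i] and let [H u = F (e^u - 1)] be the distribution function
   of [ln (1 + gamma)]. Independence and the layer-cake formula give, for each
   beam, the rate [int_0^oo (1 - prod_i max (H u) q_i) du]. The hypothesis on [f']
   says that [(1 + t) * f t] is nonincreasing, whence [H u / u] is
   nonincreasing. Majorization reduces to transfers between
   two coordinates, replacing [a >= b] among the [q_i] by [a >= a' >= b' >= b]
   with the same sum. The difference
   [max s a' * max s b' - max s a * max s b] changes sign once, from [+] to [-],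
   so the nondecreasing factor contributed by the other users may be frozen at
   the sign change; replacing [H] by a chord then leaves an explicit integral. *)
Require Import Defs.
From HB Require Import structures.
From mathcomp Require Import all_boot all_order all_algebra.
From mathcomp Require Import all_classical all_reals all_analysis.
From mathcomp Require Import measurable_realfun ring lra.
Import Order.TTheory GRing.Theory Num.Theory.
Import numFieldNormedType.Exports.
Local Open Scope classical_set_scope.
Local Open Scope ring_scope.

(** * Transfers and majorization *)

(** What two users contribute to the probability that all reports stay below a level: [s] is the
    SINR distribution function there, [a] and [b] are the probabilities of not reporting. *)
Definition maxmul {R : realType} (a b s : R) : R := Num.max s a * Num.max s b.

(** On [[0, a']] the maxima with [a] and [a'] are constant, so the difference has slope [0] up to
    [b], [- a] up to [b'] and [a' - a] afterwards. *)
Lemma maxmul_sub_nincr (R : realType) (a b a' b' s t : R) :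
  0 <= b -> b <= b' -> b' <= a' -> a' <= a -> a + b = a' + b' ->
  0 <= s -> s <= t -> t <= a' ->
  maxmul a' b' t - maxmul a b t <= maxmul a' b' s - maxmul a b s.
Proof.
move=> b0 bb ba aa e s0 st ta; rewrite /maxmul.
have -> : Num.max t a' = a' by apply/max_idPr.
have -> : Num.max t a = a by apply/max_idPr; lra.
have -> : Num.max s a' = a' by apply/max_idPr; lra.
have -> : Num.max s a = a by apply/max_idPr; lra.
have [tb'|tb'] := leP t b'; have [tb|tb] := leP t b;
have [sb'|sb'] := leP s b'; have [sb|sb] := leP s b; nra.
Qed.

(** Up to [a] the difference is [t ^ 2 - a * t], which increases because
    [a <= a + b = a' + b' <= 2 * a']; from [a] on it vanishes. *)
Lemma maxmul_sub_ndecr (R : realType) (a b a' b' s t : R) :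
  0 <= b -> b <= b' -> b' <= a' -> a' <= a -> a + b = a' + b' ->
  a' <= s -> s <= t ->
  maxmul a' b' s - maxmul a b s <= maxmul a' b' t - maxmul a b t.
Proof.
move=> b0 bb ba aa e s0 st; rewrite /maxmul.
have -> : Num.max t a' = t by apply/max_idPl; lra.
have -> : Num.max t b' = t by apply/max_idPl; lra.
have -> : Num.max t b = t by apply/max_idPl; lra.
have -> : Num.max s a' = s by apply/max_idPl; lra.
have -> : Num.max s b' = s by apply/max_idPl; lra.
have -> : Num.max s b = s by apply/max_idPl; lra.
have [ta|ta] := leP t a; have [sa|sa] := leP s a; nra.
Qed.

(* [a' * b' / a] is where [maxmul a' b' - maxmul a b] changes sign. *)
Lemma maxmul_sub_weight (R : realType) (a b a' b' s : R) (c : R -> R) :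
  0 <= b -> b <= b' -> b' <= a' -> a' <= a -> a + b = a' + b' -> 0 < a ->
  0 <= s -> (forall x y, x <= y -> c x <= c y) ->
  c s * (maxmul a' b' s - maxmul a b s) <=
  c (a' * b' / a) * (maxmul a' b' s - maxmul a b s).
Proof.
move=> b0 bb ba aa e a0 s0 cm.
have ez : a * (a' * b' / a) = a' * b' by field; lra.
have zb : a' * b' / a <= b' by rewrite ler_pdivrMr//; nra.
have bz : b <= a' * b' / a by rewrite ler_pdivlMr//; nra.
(* The crossing point is kept only through [a * z = a' * b'] and [b <= z <= b'], so the remaining
   cases are polynomial. *)
move: (a' * b' / a) ez zb bz => z ez zb bz.
have [sz|zs] := leP s z.
- rewrite ler_wpM2r ?cm// subr_ge0 /maxmul.
  have -> : Num.max s a' = a' by apply/max_idPr; lra.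
  have -> : Num.max s a = a by apply/max_idPr; lra.
  have -> : Num.max s b' = b' by apply/max_idPr; lra.
  have [sb|sb] := leP s b; nra.
- apply: ler_wnM2r; last by rewrite cm// ltW.
  rewrite subr_le0 /maxmul.
  have -> : Num.max s b = s by apply/max_idPl; lra.
  have [sa'|sa'] := leP s a'; have [sb'|sb'] := leP s b';
  have [sa|sa] := leP s a; nra.
Qed.

(** The Robin Hood transfer of majorization theory. *)
Definition transfer {R : realType} {n : nat} (x : 'I_n -> R) (j k : 'I_n)
    (e : R) : 'I_n -> R :=
  fun i => if i == j then x j - e else if i == k then x k + e else x i.

Section Majorization.
Context {R : realType} {n : nat} (phi : ('I_n -> R) -> \bar R).
Hypothesis phi_transfer : forall (x : 'I_n -> R) (j k : 'I_n) (e : R),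
  unit_cube x -> j != k -> 0 <= e ->
  x k + e <= x j - e -> (phi x <= phi (transfer x j k e))%E.

(** Prefixes are taken in index order, without sorting, because a transfer can destroy the order of
    [x]. *)
Definition prefix_ge (x y : 'I_n -> R) : Prop :=
  forall j : nat, \sum_(i < n | (i < j)%N) y i <= \sum_(i < n | (i < j)%N) x i.

(* Hardy-Littlewood-Polya: for the first [k] with [x k < y k] there is some
   [j < k] with [y j < x j]; moving [min (x j - y j) (y k - x k)] from [j] to [k]
   keeps the prefix sums of [x] above those of [y] and makes one more coordinate
   agree. Only [y] has to be sorted. *)
Lemma prefix_ge_schur (x y : 'I_n -> R) :
  unit_cube x -> unit_cube y -> {homo y : i j / (i <= j)%N >-> j <= i} ->
  prefix_ge x y -> \sum_i x i = \sum_i y i -> (phi x <= phi y)%E.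
Proof.
move=> + cy ydec.
have [m] := ubnP #|[pred i | x i != y i]|.
elim: m x => // m IH x xym cx pxy sxy.
have [[k /andP[xyk kmin]]|nok] := pselect (exists k : 'I_n, (x k < y k) &&
    [forall i : 'I_n, (i < k)%N ==> (y i <= x i)]); last first.
  (* Without a deficient coordinate [x] dominates [y] pointwise, and the equal sums force
     [x = y]. *)
  have yx i : y i <= x i.
    rewrite leNgt; apply/negP => xyi; apply: nok.
    case: (@arg_minnP _ i [pred i | x i < y i] val xyi) => k /= xyk kmin.
    exists k; rewrite xyk; apply/forallP => l; apply/implyP => lk.
    by rewrite leNgt; apply/negP => /kmin; rewrite leqNgt lk.
  have : \sum_i (x i - y i) = 0 by rewrite sumrB sxy subrr.
  move/eqP; rewrite psumr_eq0; last by move=> i _; rewrite subr_ge0.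
  move=> /allP xy; suff -> : x = y by [].
  apply/funext => i; apply/eqP; rewrite -subr_eq0.
  by apply: xy; rewrite mem_index_enum.
have {}kmin (i : 'I_n) : (i < k)%N -> y i <= x i by move=> ik; have /forallP/(_ i) := kmin; rewrite ik.
(* Otherwise no coordinate before [k] has a surplus, and the deficit at [k] violates the prefix
   inequality of length [k + 1]. *)
have [j [jk yxj]] : exists j : 'I_n, (j < k)%N /\ y j < x j.
  apply: contrapT => noj.
  have := pxy k.+1; rewrite leNgt => /negP; apply.
  rewrite (bigD1 k)//= [ltRHS](bigD1 k)//=.
  apply: ltr_leD => //; apply: ler_sum => i /andP[ik nik].
  have {}ik : (i < k)%N by rewrite ltn_neqAle nik -ltnS.
  by rewrite leNgt; apply/negP => yxi; apply: noj; exists i.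
have njk : j != k by rewrite -val_eqE ltn_eqF.
pose e := Num.min (x j - y j) (y k - x k).
have e1 : e <= x j - y j by rewrite ge_min lexx.
have e2 : e <= y k - x k by rewrite ge_min lexx orbT.
have e0 : 0 < e by rewrite lt_min !subr_gt0 yxj.
(* Sortedness of [y] makes the transfer admissible: [x k + e <= y k <= y j <= x j - e]. *)
have yjk : y k <= y j by apply: ydec; exact: ltnW.
have xjk : x k + e <= x j - e by lra.
apply: le_trans (phi_transfer _ _ _ _ cx njk (ltW e0) xjk) _.
have tj : transfer x j k e j = x j - e by rewrite /transfer eqxx.
have tk : transfer x j k e k = x k + e by rewrite /transfer eq_sym (negbTE njk) eqxx.
have ti i : i != j -> i != k -> transfer x j k e i = x i.
  by rewrite /transfer => /negbTE -> /negbTE ->.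
have sumt (Q : pred 'I_n) : Q j -> Q k ->
    \sum_(i | Q i) transfer x j k e i = \sum_(i | Q i) x i.
  move=> Qj Qk; rewrite (bigD1 j)//= (bigD1 k)/=; last by rewrite Qk eq_sym.
  rewrite [RHS](bigD1 j)//= [X in _ = _ + X](bigD1 k)/=; last by rewrite Qk eq_sym.
  rewrite tj tk (eq_bigr x) => [|i /andP[/andP[_ ij] ik]]; last exact: ti.
  by ring.
apply: IH.
(* The set of disagreements shrinks strictly: it gains no index and loses [j] or [k], whichever
   attains the minimum [e]. *)
- rewrite -ltnS; apply: leq_trans xym.
  apply: proper_card; apply/properP; split.
    apply/fintype.subsetP => i; rewrite !inE.
    have [->|ij] := eqVneq i j; first by move=> _; rewrite gt_eqF.
    have [->|ik] := eqVneq i k; first by move=> _; rewrite lt_eqF.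
    by rewrite ti.
  have [exj|] := leP (x j - y j) (y k - x k).
  + exists j; first by rewrite inE gt_eqF.
    by rewrite inE tj /e min_l// opprB addrCA subrr addr0 eqxx.
  + move=> /ltW exj; exists k; first by rewrite inE lt_eqF.
    by rewrite inE tk /e min_r// addrCA subrr addr0 eqxx.
- move=> i; have [->|ij] := eqVneq i j.
    by rewrite tj; have := cx j; have := cy j; move=> /andP[? ?] /andP[? ?]; lra.
  have [->|ik] := eqVneq i k; last by rewrite ti.
  by rewrite tk; have := cx k; have := cy k; move=> /andP[? ?] /andP[? ?]; lra.
(* A prefix reaching past [k] contains both [j] and [k], so its sum is unchanged; a shorter one has
   only indices before [k], where the new vector still dominates [y]. *)
- move=> l; have [kl|lk] := ltnP k l.
    by rewrite sumt ?pxy// (ltn_trans jk).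
  apply: ler_sum => i il; have ik : (i < k)%N by exact: leq_trans lk.
  have [->|ij] := eqVneq i j; first by rewrite tj; lra.
  by rewrite ti// ?kmin// -val_eqE ltn_eqF.
- by rewrite sumt.
Qed.

Hypothesis phi_perm : forall x y : 'I_n -> R, perm_eq [seq x i | i <- enum 'I_n]
  [seq y i | i <- enum 'I_n] -> phi x = phi y.

(** By symmetry of [phi] both vectors may be replaced by their decreasing rearrangements [S x] and
    [S y], for which majorization becomes [prefix_ge]. *)
Lemma schur_concave_transfer : schur_concave_on (@unit_cube R n) phi.
Proof.
pose S (x : 'I_n -> R) : 'I_n -> R := fun i => nth 0 (dec_sorted x) i.
have szS (x : 'I_n -> R) : size (dec_sorted x) = n.
  by rewrite size_sort size_map size_enum_ord.
have mapS (x : 'I_n -> R) : [seq S x i | i <- enum 'I_n] = dec_sorted x.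
  apply: (@eq_from_nth _ 0); first by rewrite size_map size_enum_ord szS.
  move=> i; rewrite size_map size_enum_ord => ni.
  by rewrite (nth_map (Ordinal ni)) ?size_enum_ord// /S nth_enum_ord.
have phiS (x : 'I_n -> R) : phi x = phi (S x).
  by apply: phi_perm; rewrite mapS perm_sym perm_sort.
have cS (x : 'I_n -> R) : unit_cube x -> unit_cube (S x).
  move=> cx i; have : S x i \in dec_sorted x by rewrite mem_nth// szS.
  by rewrite mem_sort => /mapP[k _ ->]; exact: cx.
have sumS (x : 'I_n -> R) (j : nat) : (j <= n)%N ->
    \sum_(a <- take j (dec_sorted x)) a = \sum_(i < n | (i < j)%N) S x i.
  move=> jn; rewrite (big_nth 0) size_takel ?szS// big_mkord.
  rewrite (big_ord_widen_cond n (fun _ => true) (fun i => nth 0 (take j (dec_sorted x)) i) jn)/=.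
  by apply: eq_bigr => i ij; rewrite nth_take.
have sumST (x : 'I_n -> R) : \sum_(a <- dec_sorted x) a = \sum_i S x i.
  by rewrite -mapS big_map big_enum.
move=> x y cx cy [pxy sxy]; rewrite (phiS x) (phiS y).
apply: prefix_ge_schur; [exact: cS|exact: cS| | |by rewrite -!sumST].
- move=> i j ij; apply: (@sorted_leq_nth _ (fun a b : R => b <= a)); rewrite ?inE ?szS//.
  + by move=> u v w /= vu wv; exact: le_trans vu.
  + by apply: sort_sorted => u v; rewrite le_total.
(* Majorization covers lengths [1] to [n - 1]; length [0] is empty, and from [n] on the prefix is
   the whole sum. *)
- move=> j; have [->|j0] := posnP j; first by rewrite !big_pred0.
  have [jn|nj] := ltnP j n.
    by rewrite -!sumS 1?ltnW// pxy// j0/= -ltnS prednK// (leq_trans _ jn).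
  rewrite (eq_bigl xpredT) => [|i]; last by rewrite (leq_trans (ltn_ord i)).
  rewrite [leRHS](eq_bigl xpredT) => [|i]; last by rewrite (leq_trans (ltn_ord i)).
  by rewrite -!sumST sxy.
Qed.

End Majorization.

(** * The effect of a transfer on the integral *)

Lemma ge0_integral_itvcc_split (R : realType) (x y z : R) (g : R -> \bar R) :
  x <= y -> y <= z -> measurable_fun `[x, z] g ->
  (forall t, x <= t <= z -> (0 <= g t)%E) ->
  (\int[lebesgue_measure]_(t in `[x, z]) g t =
   \int[lebesgue_measure]_(t in `[x, y]) g t +
   \int[lebesgue_measure]_(t in `[y, z]) g t)%E.
Proof.
move=> xy yz mg g0.
have e : `[x, z]%classic = `[x, y]%classic `|` `]y, z]%classic.
  by rewrite -itv_bndbnd_setU.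
have mg' : measurable_fun (`[x, y]%classic `|` `]y, z]%classic) g by rewrite -e.
rewrite {1}e ge0_integral_setU//=; last 2 first.
- move=> t; rewrite !in_itv/= => -[] /andP[? ?]; apply: g0; apply/andP; split=> //.
  + exact: le_trans yz.
  + by apply/ltW/(le_lt_trans xy).
- apply/disj_setPS => t/=; rewrite !in_itv/= => -[/andP[_ ty] /andP[yt _]].
  by have := lt_le_trans yt ty; rewrite ltxx.
congr (_ + _)%E; rewrite integral_itv_obnd_cbnd//.
by apply: measurable_funS mg => //; apply: subset_itvr; rewrite bnd_simp.
Qed.

Lemma integral_quadratic (R : realType) (x y c0 c1 c2 : R) : x <= y ->
  (\int[lebesgue_measure]_(u in `[x, y]) (c0 + c1 * u + c2 * u ^+ 2)%:E =
   (c0 * (y - x) + c1 / 2 * (y ^+ 2 - x ^+ 2) + c2 / 3 * (y ^+ 3 - x ^+ 3))%:E)%E.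
Proof.
rewrite le_eqVlt => /predU1P[->|xy].
  by rewrite set_itv1 integral_set1 !subrr !mulr0 !addr0//.
pose G (u : R) : R := c0 * u + c1 / 2 * u ^+ 2 + c2 / 3 * u ^+ 3.
have dG (u : R) : is_derive u 1 G (c0 + c1 * u + c2 * u ^+ 2).
  rewrite /G; apply: is_derive_eq.
  by rewrite /GRing.scale/=; field.
have cG : continuous G.
  move=> u; apply: differentiable_continuous; apply/derivable1_diffP.
  by have [] := dG u.
rewrite (@continuous_FTC2 _ _ G)//.
- by rewrite -EFinB; congr EFin; rewrite /G; ring.
- apply: continuous_subspaceT => u.
  apply: cvgD; last by apply: cvgM; [exact: cvg_cst|exact: exprn_continuous].
  by apply: cvgD; [exact: cvg_cst|apply: cvgM; [exact: cvg_cst|exact: cvg_id]].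
- split; first by move=> u _; have [] := dG u.
  + by apply: cvg_at_right_filter; exact: cG.
  + by apply: cvg_at_left_filter; exact: cG.
- by move=> u _; rewrite derive1E; have [_ ] := dG u.
Qed.

Lemma measurable_maxmul (R : realType) (a b : R) (D : set R) (g : R -> R) :
  measurable_fun D g -> measurable_fun D (fun u => maxmul a b (g u)).
Proof.
by move=> mg; apply: measurable_funM; apply: measurable_maxr => //.
Qed.

Lemma maxmul_ge0 (R : realType) (a b s : R) : 0 <= b -> 0 <= a ->
  0 <= maxmul a b s.
Proof. by move=> b0 a0; rewrite mulr_ge0// le_max ?a0 ?b0 orbT. Qed.

(** The line crosses [b] and [a] at [b / k] and [a / k]; on the three pieces the integrand is
    [a * b], [a * k * u] and [(k * u) ^ 2]. *)
Lemma integral_maxmul_linear (R : realType) (a b k w : R) :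
  0 < k -> 0 <= b -> b <= a -> a <= k * w ->
  (\int[lebesgue_measure]_(u in `[0%R, w]) (maxmul a b (k * u))%:E =
   ((a * b ^+ 2 / 2 + a ^+ 3 / 6 + (k * w) ^+ 3 / 3) / k)%:E)%E.
Proof.
move=> k0 b0 ba akw.
have me (D : set R) : measurable_fun D (fun u => (maxmul a b (k * u))%:E).
  apply/measurable_EFinP; apply: measurable_maxmul.
  exact: measurable_funM.
have e0 (u : R) : (0 <= (maxmul a b (k * u))%:E)%E.
  by rewrite lee_fin maxmul_ge0// (le_trans b0).
have bk0 : 0 <= b / k by rewrite divr_ge0// ltW.
have bak : b / k <= a / k by rewrite ler_pM2r// invr_gt0.
have akw' : a / k <= w by rewrite ler_pdivrMr// mulrC.
rewrite (@ge0_integral_itvcc_split _ _ (b / k))//; last by exact: le_trans akw'.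
rewrite (@ge0_integral_itvcc_split _ (b / k) (a / k) w)//.
have -> : (\int[lebesgue_measure]_(t in `[0%R, (b / k)%R]) (maxmul a b (k * t))%:E =
    \int[lebesgue_measure]_(t in `[0%R, (b / k)%R]) (a * b + 0 * t + 0 * t ^+ 2)%:E)%E.
  apply: eq_integral => u; rewrite inE/= in_itv/= ler_pdivlMr// mulrC => /andP[_ ub].
  congr EFin; rewrite /maxmul !(max_idPr _)//; first ring.
  exact: le_trans ba.
have -> : (\int[lebesgue_measure]_(t in `[(b / k)%R, (a / k)%R]) (maxmul a b (k * t))%:E =
    \int[lebesgue_measure]_(t in `[(b / k)%R, (a / k)%R]) (0 + a * k * t + 0 * t ^+ 2)%:E)%E.
  apply: eq_integral => u; rewrite inE/= in_itv/= ler_pdivlMr// ler_pdivrMr// mulrC => /andP[bu ua].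
  by congr EFin; rewrite /maxmul (max_idPr _)// (max_idPl _)//; ring.
have -> : (\int[lebesgue_measure]_(t in `[(a / k)%R, w]) (maxmul a b (k * t))%:E =
    \int[lebesgue_measure]_(t in `[(a / k)%R, w]) (0 + 0 * t + k ^+ 2 * t ^+ 2)%:E)%E.
  apply: eq_integral => u; rewrite inE/= in_itv/= ler_pdivrMr// mulrC => /andP[au _].
  congr EFin; rewrite /maxmul !(max_idPl _)//; first ring.
  exact: le_trans au.
rewrite !integral_quadratic// -!EFinD; congr EFin.
by field; rewrite gt_eqF.
Qed.

Lemma maxmul_le1 (R : realType) (a b s : R) : 0 <= s -> s <= 1 -> a <= 1 ->
  b <= 1 -> maxmul a b s <= 1.
Proof.
move=> s0 s1 a1 b1; apply: mulr_ile1; rewrite ?ge_max ?s1 ?a1 ?b1//.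
- by rewrite le_max s0.
- by rewrite le_max s0.
Qed.

(* The chord [u |-> a' / v * u] lies below [H] up to [v] and above it afterwards,
   and [maxmul a' b' - maxmul a b] decreases up to [a' = H v] and increases
   afterwards; so replacing [H] by its chord increases the difference of the two
   integrands, and for the chord the difference integrates to
   [(a' - b') ^ 3 - (a - b) ^ 3 <= 0] up to a positive factor. *)
Lemma integral_one_sub_maxmul_le (R : realType) (H c : R -> R) (a b a' b' v : R) :
  measurable_fun `[(0 : R), +oo[ H -> (forall u, 0 <= u -> 0 <= H u <= 1) ->
  (forall t u, 0 <= t -> t <= u -> H t <= H u) ->
  (forall t u, 0 <= t -> t <= u -> H u * t <= H t * u) ->
  (forall s t, s <= t -> c s <= c t) ->
  (forall s, 0 <= s <= 1 -> 0 <= c s <= 1) ->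
  0 <= b -> b <= b' -> b' <= a' -> a' <= a -> a <= 1 -> a + b = a' + b' ->
  0 < a' -> 0 < v -> H v = a' ->
  (\int[lebesgue_measure]_(u in `[0%R, +oo[) (1 - c (H u) * maxmul a b (H u))%:E <=
   \int[lebesgue_measure]_(u in `[0%R, +oo[) (1 - c (H u) * maxmul a' b' (H u))%:E)%E.
Proof.
move=> mH H01 Hmono Hray cmono c01 b0 bb ba aa a1 e a'0 v0 Hv.
have a0 : 0 < a by exact: lt_le_trans aa.
(* [k] is the slope of the chord and [w] the point where it reaches [a]; beyond [w] both chord
   products equal [(k * u) ^ 2]. *)
pose k := a' / v; pose w := a * v / a'.
have k0 : 0 < k by rewrite divr_gt0.
have kw : k * w = a by rewrite /k /w; field; rewrite !gt_eqF.
have w0 : 0 < w by rewrite divr_gt0// mulr_gt0.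
have c0 : 0 <= c (a' * b' / a).
  have /c01/andP[] // : 0 <= a' * b' / a <= 1.
  by rewrite divr_ge0 ?mulr_ge0 ?(ltW a0)//=; [rewrite ler_pdivrMr//; nra|lra|lra].
set c0' := c (a' * b' / a) in c0.
(* Each side receives its own frozen chord product, rather than a difference, so that all integrands
   stay nonnegative. *)
have key u : 0 <= u -> 1 - c (H u) * maxmul a b (H u) + c0' * maxmul a b (k * u) <=
    1 - c (H u) * maxmul a' b' (H u) + c0' * maxmul a' b' (k * u).
  move=> u0; have /andP[Hu0 Hu1] := H01 u u0.
  have := @maxmul_sub_weight _ a b a' b' (H u) c b0 bb ba aa e a0 Hu0 cmono.
  suff : c0' * (maxmul a' b' (H u) - maxmul a b (H u)) <=
         c0' * (maxmul a' b' (k * u) - maxmul a b (k * u)) by rewrite -/c0'; lra.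
  apply: ler_wpM2l => //.
  have ku : k * u = a' * u / v by rewrite /k; field; rewrite gt_eqF.
  have [uv|/ltW vu] := leP u v.
  - apply: maxmul_sub_nincr => //.
    + by rewrite mulr_ge0// ltW.
    + by rewrite ku ler_pdivrMr// -Hv; exact: Hray.
    + by rewrite -Hv; exact: Hmono.
  - apply: maxmul_sub_ndecr => //.
    + by rewrite -Hv; apply: Hmono => //; exact: ltW.
    + by rewrite ku ler_pdivlMr// -Hv; apply: Hray => //; exact: ltW.
have mA p q : measurable_fun `[(0 : R), +oo[ (fun u => (1 - c (H u) * maxmul p q (H u))%:E).
  apply/measurable_EFinP; apply: measurable_funB => //.
  apply: measurable_funM; last exact: measurable_maxmul.
  apply: (@measurable_comp _ _ _ _ _ _ setT) => //.
  by apply: nondecreasing_measurable => // s t; exact: cmono.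
have A0 p q u : p <= 1 -> q <= 1 -> 0 <= p -> 0 <= q -> 0 <= u ->
    (0 <= (1 - c (H u) * maxmul p q (H u))%:E)%E.
  move=> p1 q1 p0 q0 /H01 Hu; rewrite lee_fin subr_ge0.
  have /andP[? ?] := c01 _ Hu; case/andP: Hu => ? ?.
  by rewrite mulr_ile1 ?maxmul_ge0 ?maxmul_le1.
(* The chord products grow quadratically, so they are added and cancelled only on [[0, w]], where
   their integrals are finite; on the tail they coincide pointwise. *)
have split p q : p <= 1 -> q <= 1 -> 0 <= p -> 0 <= q ->
    (\int[lebesgue_measure]_(u in `[0%R, +oo[) (1 - c (H u) * maxmul p q (H u))%:E =
     \int[lebesgue_measure]_(u in `[0%R, w]) (1 - c (H u) * maxmul p q (H u))%:E +
     \int[lebesgue_measure]_(u in `]w, +oo[) (1 - c (H u) * maxmul p q (H u))%:E)%E.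
  move=> p1 q1 p0 q0.
  have e01 : `[(0 : R), +oo[%classic = `[0, w]%classic `|` `]w, +oo[%classic.
    by rewrite -itv_bndbnd_setU// bnd_simp ltW.
  rewrite e01 ge0_integral_setU//=.
  - by rewrite -e01; exact: mA.
  - move=> u; rewrite !in_itv/= andbT => -[/andP[u0 _]|wu]; apply: A0 => //.
    by apply/ltW/(lt_trans w0).
  - apply/disj_setPS => u/=; rewrite !in_itv/= andbT => -[/andP[_ uw] wu].
    by have := lt_le_trans wu uw; rewrite ltxx.
have a'1 : a' <= 1 by lra.
have b1 : b <= 1 by lra.
have b'1 : b' <= 1 by lra.
have b'0 : 0 <= b' by lra.
have sub1 : `[0, w] `<=` `[(0 : R), +oo[ by apply: subset_itvl.
have sub2 : `]w, +oo[ `<=` `[(0 : R), +oo[ by apply: subset_itvr; rewrite bnd_simp ltW.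
rewrite !split ?(ltW a0) ?(ltW a'0)//; apply: leeD; last first.
  apply: ge0_le_integral => //=.
  - by move=> u; rewrite in_itv/= andbT => wu; rewrite A0 ?(ltW a0)// ltW// (lt_trans w0).
  - exact: measurable_funS (mA _ _).
  - exact: measurable_funS (mA _ _).
  - move=> u; rewrite in_itv/= andbT => wu; rewrite lee_fin.
    have u0 : 0 <= u by rewrite ltW// (lt_trans w0).
    have := key u u0.
    have aku : a <= k * u by rewrite -kw ler_pM2l// ltW.
    have mm p q : p <= a -> q <= a -> maxmul p q (k * u) = k * u * (k * u).
      by move=> pa qa; rewrite /maxmul !(max_idPl _)//; exact: le_trans aku.
    by rewrite !mm ?lerD2r//; lra.
have mE p q : measurable_fun `[0, w] (fun u => (maxmul p q (k * u))%:E).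
  by apply/measurable_EFinP; apply: measurable_maxmul; exact: measurable_funM.
have mAE p q : measurable_fun `[0, w]
    (fun u => (1 - c (H u) * maxmul p q (H u) + c0' * maxmul p q (k * u))%:E).
  apply/measurable_EFinP; apply: measurable_funD.
    by apply/measurable_EFinP; exact: measurable_funS (mA _ _).
  by apply: measurable_funM => //; apply/measurable_EFinP; exact: mE.
have intD p q : p <= 1 -> q <= 1 -> 0 <= p -> 0 <= q ->
    (\int[lebesgue_measure]_(u in `[0%R, w]) (1 - c (H u) * maxmul p q (H u))%:E +
      c0'%:E * \int[lebesgue_measure]_(u in `[0%R, w]) (maxmul p q (k * u))%:E =
     \int[lebesgue_measure]_(u in `[0%R, w])
       (1 - c (H u) * maxmul p q (H u) + c0' * maxmul p q (k * u))%:E)%E.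
  move=> p1 q1 p0 q0.
  under [RHS]eq_integral do rewrite EFinD EFinM.
  rewrite ge0_integralD//=.
  - rewrite ge0_integralZl_EFin//; last exact: mE.
    by move=> u _; rewrite lee_fin; exact: maxmul_ge0.
  - by move=> u; rewrite in_itv/= => /andP[u0 _]; exact: A0.
  - exact: measurable_funS (mA _ _).
  - by move=> u _; rewrite -EFinM lee_fin mulr_ge0// maxmul_ge0.
  - by apply: emeasurable_funM => //; exact: mE.
have : (\int[lebesgue_measure]_(u in `[0%R, w]) (1 - c (H u) * maxmul a b (H u))%:E +
    c0'%:E * \int[lebesgue_measure]_(u in `[0%R, w]) (maxmul a b (k * u))%:E <=
  \int[lebesgue_measure]_(u in `[0%R, w]) (1 - c (H u) * maxmul a' b' (H u))%:E +
    c0'%:E * \int[lebesgue_measure]_(u in `[0%R, w]) (maxmul a' b' (k * u))%:E)%E.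
  rewrite !intD ?(ltW a0) ?(ltW a'0)//; apply: ge0_le_integral => //=.
  - move=> u; rewrite in_itv/= => /andP[u0 _].
    rewrite EFinD adde_ge0// ?A0 ?(ltW a0)//.
    by rewrite lee_fin mulr_ge0// maxmul_ge0// ltW.
  - exact: mAE.
  - exact: mAE.
  - by move=> u; rewrite in_itv/= => /andP[u0 _]; rewrite lee_fin; exact: key.
rewrite !integral_maxmul_linear ?kw//; last by lra.
rewrite -!EFinM => le1.
rewrite -(leeD2rE (x := (c0' * ((a * b ^+ 2 / 2 + a ^+ 3 / 6 + a ^+ 3 / 3) / k))%:E))//.
apply: le_trans le1 _; rewrite leeD2l// lee_fin ler_wpM2l// ler_pM2r ?invr_gt0//.
(* Since [a + b = a' + b'], only the cubes of the gaps [a - b] and [a' - b'] remain to be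
   compared. *)
have -> : a * b ^+ 2 / 2 + a ^+ 3 / 6 = ((a + b) ^+ 3 + (a - b) ^+ 3) / 12 by field.
have -> : a' * b' ^+ 2 / 2 + a' ^+ 3 / 6 = ((a' + b') ^+ 3 + (a' - b') ^+ 3) / 12 by field.
rewrite e lerD2r ler_pM2r ?invr_gt0// lerD2l lerXn2r// ?nnegrE; lra.
Qed.

(** * The SINR distribution function *)

Lemma continuous_inv1D (R : realType) (s t : R) : 0 <= s ->
  {within `[s, t], continuous (fun r : R => (1 + r)^-1)}.
Proof.
move=> s0; apply: continuous_in_subspaceT => r; rewrite inE/= in_itv/= => /andP[sr _].
apply: continuousV; first by rewrite gt_eqF// ltr_pwDl// (le_trans s0).
by apply: cvgD; [exact: cvg_cst|exact: cvg_id].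
Qed.

Lemma measurable_inv1D (R : realType) (s t : R) : 0 <= s ->
  measurable_fun `]s, t] (fun r : R => (1 + r)^-1).
Proof.
move=> s0; have ci := @continuous_inv1D _ s t s0.
apply: measurable_funS (subspace_continuous_measurable_fun _ ci) => //.
exact: subset_itv_oc_cc.
Qed.

Lemma integral_inv1D (R : realType) (s t : R) : 0 <= s -> s <= t ->
  (\int[lebesgue_measure]_(r in `]s, t]) ((1 + r)^-1)%:E =
   (ln (1 + t) - ln (1 + s))%:E)%E.
Proof.
move=> s0 sLt; have [<-|nst] := eqVneq s t.
  by rewrite set_itvoc0 integral_set0 subrr.
have st : s < t by rewrite lt_neqAle nst.
have dL (r : R) : 0 <= r -> is_derive r 1 (fun x : R => ln (1 + x)) ((1 + r)^-1).
  move=> r0; have r1 : 0 < 1 + r by rewrite ltr_pwDl.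
  have h : is_derive r 1 (fun x : R => 1 + x) 1.
    by apply: is_derive_eq; rewrite add0r mulr1.
  have := @is_derive1_comp _ (@ln R) (fun x => 1 + x) r _ _ (is_derive1_ln r1) h.
  by rewrite mulr1.
have cL (r : R) : 0 <= r -> {for r, continuous (fun x : R => ln (1 + x))}.
  move=> r0; apply: differentiable_continuous; apply/derivable1_diffP.
  by have [] := dL r r0.
rewrite integral_itv_obnd_cbnd; last by apply/measurable_EFinP; exact: measurable_inv1D.
rewrite (@continuous_FTC2 _ _ (fun x : R => ln (1 + x)))//.
- exact: continuous_inv1D.
- split.
  + by move=> r; rewrite in_itv/= => /andP[sr _]; have [] := dL r (ltW (le_lt_trans s0 sr)).
  + by apply: cvg_at_right_filter; exact: cL.
  + by apply: cvg_at_left_filter; apply: cL; exact: le_trans sLt.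
- move=> r; rewrite in_itv/= => /andP[sr _].
  by rewrite derive1E; have [_ ] := dL r (ltW (le_lt_trans s0 sr)).
Qed.

Lemma Finv_incr (R : realType) (F : R -> R) (t : R) : 0 <= t ->
  (forall x y, 0 <= x -> x < y -> F x < F y) -> Finv F (F t) = t%:E.
Proof.
move=> t0 Fi; apply/eqP; rewrite eq_le; apply/andP; split.
  by apply: ereal_inf_lbound; exists t.
apply: le_ereal_inf_tmp => _ [s [s0 Fts] <-]; rewrite lee_fin leNgt.
by apply/negP => /(Fi _ _ s0); rewrite ltNge Fts.
Qed.

Section Cdf.
Context {R : realType} (F f : R -> R).
Hypothesis mf : measurable_fun setT f.
Hypothesis f0 : forall t, 0 <= f t.
Hypothesis FE : forall x,
  ((F x)%:E = \int[lebesgue_measure]_(t in `]-oo, x]) (f t)%:E)%E.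

Lemma distfun_sub (s t : R) : s <= t ->
  ((F t - F s)%:E = \int[lebesgue_measure]_(r in `]s, t]) (f r)%:E)%E.
Proof.
move=> st.
have mfD (D : set R) : measurable D -> measurable_fun D (fun r => (f r)%:E).
  by move=> mD; apply/measurable_EFinP; exact: measurable_funS mf.
have e : `]-oo, t]%classic = `]-oo, s]%classic `|` `]s, t]%classic.
  by rewrite -itv_bndbnd_setU// bnd_simp.
have := FE t; rewrite e ge0_integral_setU//=.
- rewrite -FE EFinB => ->; rewrite addeAC subee// add0e//.
- by apply: mfD; exact: measurableU.
- by move=> r _; rewrite lee_fin.
- apply/disj_setPS => r/=; rewrite !in_itv/= => -[rs /andP[sr _]].
  by have := le_lt_trans rs sr; rewrite ltxx.
Qed.

Lemma distfun_nondecreasing (s t : R) : s <= t -> F s <= F t.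
Proof.
move=> st; rewrite -subr_ge0 -lee_fin distfun_sub//.
by apply: integral_ge0 => r _; rewrite lee_fin.
Qed.

Lemma distfun_sub_le (s t : R) (h : R -> R) : s <= t -> measurable_fun `]s, t] h ->
  (forall r, s < r -> r <= t -> f r <= h r) ->
  ((F t - F s)%:E <= \int[lebesgue_measure]_(r in `]s, t]) (h r)%:E)%E.
Proof.
move=> st mh fh; rewrite distfun_sub//; apply: ge0_le_integral => //=.
- by move=> r _; rewrite lee_fin.
- by apply/measurable_EFinP; exact: measurable_funS mf.
- exact/measurable_EFinP.
- by move=> r; rewrite in_itv/= lee_fin => /andP[sr rt]; exact: fh.
Qed.

Lemma distfun_sub_ge (s t : R) (h : R -> R) : s <= t -> measurable_fun `]s, t] h ->
  (forall r, s < r -> r <= t -> 0 <= h r <= f r) ->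
  (\int[lebesgue_measure]_(r in `]s, t]) (h r)%:E <= (F t - F s)%:E)%E.
Proof.
move=> st mh fh; rewrite distfun_sub//; apply: ge0_le_integral => //=.
- by move=> r; rewrite in_itv/= lee_fin => /andP[sr rt]; have /andP[] := fh _ sr rt.
- exact/measurable_EFinP.
- by apply/measurable_EFinP; exact: measurable_funS mf.
- by move=> r; rewrite in_itv/= lee_fin => /andP[sr rt]; have /andP[] := fh _ sr rt.
Qed.

Hypothesis fN : forall t : R, t < 0 -> f t = 0.

Lemma distfun_le0 (x : R) : x <= 0 -> F x = 0.
Proof.
move=> x0; apply: EFin_inj; rewrite FE.
(* The right endpoint is dropped because [f] is known to vanish only strictly below [0]. *)
rewrite -integral_itv_bndo_bndc; last by apply/measurable_EFinP; exact: measurable_funS mf.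
apply: integral0_eq => r /=; rewrite in_itv/= => rx.
by rewrite fN// (lt_le_trans rx).
Qed.

Hypothesis F1 : forall x, F x <= 1.
Hypothesis Fincr : forall x y : R, 0 <= x -> x < y -> F x < F y.
Hypothesis df : forall t : R, 0 < t -> derivable f t 1.
Hypothesis ddf : forall x : R, 0 < x < 1 ->
  derive1 f (fine (Finv F x)) <= - f (fine (Finv F x)) / (1 + fine (Finv F x)).

(* [(1 + t) * f t] is the density of [ln (1 + gamma)] at [ln (1 + t)]. *)
Lemma mul1D_density_nincr (s t : R) : 0 < s -> s <= t ->
  (1 + t) * f t <= (1 + s) * f s.
Proof.
move=> s0 st.
have dg (r : R) : 0 < r ->
    is_derive r 1 (fun x : R => (1 + x) * f x) (f r + (1 + r) * derive1 f r).
  move=> r0; have dfr := df _ r0.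
  have h1 : is_derive r 1 f (derive1 f r) by rewrite derive1E; exact: derivableP.
  by apply: is_derive_eq; rewrite /GRing.scale/=; ring.
apply: (@ler0_derive1_nincr _ (fun x : R => (1 + x) * f x) s t) => //.
- by move=> r; rewrite in_itv/= => /andP[sr _]; have [] := dg r (lt_trans s0 sr).
- move=> r; rewrite in_itv/= => /andP[sr _]; have r0 := lt_trans s0 sr.
  rewrite derive1E; have [_ ->] := dg r r0.
  (* The hypothesis is used at [x = F r], whose quantile is [r]; it makes
     [f r + (1 + r) * derive1 f r] nonpositive. *)
  have /ddf : 0 < F r < 1.
    rewrite -[X in X < F r](distfun_le0 _ (lexx 0)) Fincr//=.
    by apply: lt_le_trans (F1 (r + 1)); apply: Fincr; lra.
  rewrite Finv_incr//=; last exact: ltW.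
  rewrite ler_pdivlMr; [lra|lra].
- apply: continuous_in_subspaceT => r; rewrite inE/= in_itv/= => /andP[sr _].
  apply: differentiable_continuous; apply/derivable1_diffP.
  by have [] := dg r (lt_le_trans s0 sr).
Qed.

Lemma integral_scale_inv1D (s t k : R) : 0 <= s -> s <= t -> 0 <= k ->
  (\int[lebesgue_measure]_(r in `]s, t]) (k * (1 + r)^-1)%:E =
   (k * (ln (1 + t) - ln (1 + s)))%:E)%E.
Proof.
move=> s0 st k0; rewrite EFinM -integral_inv1D//.
under eq_integral do rewrite EFinM.
rewrite ge0_integralZl_EFin//.
- move=> r; rewrite /= in_itv/= => /andP[sr _].
  by rewrite lee_fin invr_ge0 addr_ge0// ltW// (le_lt_trans s0).
- by apply/measurable_EFinP; exact: measurable_inv1D.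
Qed.

(** Past [s] the density is at most [g / (1 + r)] with [g = (1 + s) * f s]; below [s] the same
    function bounds it from below, which gives [distfun_ge_ln]. *)
Lemma distfun_sub_le_ln (s t : R) : 0 < s -> s <= t ->
  F t - F s <= (1 + s) * f s * (ln (1 + t) - ln (1 + s)).
Proof.
move=> s0 st; rewrite -lee_fin -integral_scale_inv1D//; last 2 first.
- exact: ltW.
- by rewrite mulr_ge0// addr_ge0// ltW.
apply: distfun_sub_le => //.
  by apply: measurable_funM => //; apply: measurable_inv1D; exact: ltW.
move=> r sr rt; rewrite ler_pdivlMr; last by rewrite ltr_pwDl// (le_trans (ltW s0))// ltW.
by rewrite mulrC; apply: mul1D_density_nincr => //; exact: ltW.
Qed.

Lemma distfun_ge_ln (s : R) : 0 < s -> (1 + s) * f s * ln (1 + s) <= F s.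
Proof.
move=> s0; rewrite -[F s]subr0 -(distfun_le0 _ (lexx 0)).
have -> : ln (1 + s) = ln (1 + s) - ln (1 + 0) by rewrite addr0 ln1 subr0.
rewrite -lee_fin -integral_scale_inv1D//; last 2 first.
- exact: ltW.
- by rewrite mulr_ge0// addr_ge0// ltW.
apply: distfun_sub_ge => //; first exact: ltW.
  by apply: measurable_funM => //; apply: measurable_inv1D.
move=> r r0 rs; have r1 : 0 < 1 + r by rewrite ltr_pwDl// ltW.
apply/andP; split; first by rewrite !mulr_ge0 ?invr_ge0 ?(ltW r1) ?addr_ge0 ?(ltW s0).
by rewrite ler_pdivrMr// [leRHS]mulrC; exact: mul1D_density_nincr.
Qed.

(** With [L1], [L2] the logarithms at [s], [t], the two bounds give [(F t - F s) * L1 <= g * L1 *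
    (L2 - L1) <= F s * (L2 - L1)]. *)
Lemma distfun_ray_ln (s t : R) : 0 <= s -> s <= t ->
  F t * ln (1 + s) <= F s * ln (1 + t).
Proof.
rewrite le_eqVlt => /predU1P[<- _|s0 st].
  by rewrite addr0 ln1 mulr0 distfun_le0// mul0r.
have h1 := distfun_sub_le_ln _ _ s0 st; have h2 := distfun_ge_ln _ s0.
have l1 : 0 <= ln (1 + s) by rewrite ln_ge0// lerDl ltW.
have l2 : ln (1 + s) <= ln (1 + t).
  by rewrite ler_ln ?posrE ?lerD2l// ltr_pwDl// ?(ltW s0)// (le_trans (ltW s0)).
have f0s := f0 s; move: h1 h2 l1 l2.
move: (_ * f s) (ln _) (ln _) => g L1 L2 h1 h2 l1 l2; nra.
Qed.

Hypothesis fbd : exists delta C : R, 0 < delta /\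
  forall t, `|t| < delta -> `|f t| <= C.

(** The bound near [0] serves up to [e]; beyond [e], [f t <= (1 + t) * f t <= (1 + e) * f e]. *)
Lemma density_bounded : exists2 K, 0 < K & forall t, f t <= K.
Proof.
have [d [C [d0 fC]]] := fbd.
pose e := d / 2; have e0 : 0 < e by rewrite divr_gt0.
have ed : e < d by rewrite ltr_pdivrMr// ltr_pMr// ltr1n.
have C0 : 0 <= C by apply: le_trans (fC 0 _); rewrite ?normr0.
have g0 : 0 <= (1 + e) * f e by rewrite mulr_ge0// addr_ge0// ltW.
exists (1 + C + (1 + e) * f e); first by rewrite -addrA ltr_pwDl// addr_ge0.
move=> t; have [t0|t0] := ltP t 0; first by rewrite fN// !addr_ge0.
have [te|et] := ltP t e.
  have : `|f t| <= C by apply: fC; rewrite ger0_norm// (lt_trans te).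
  by rewrite ger0_norm// => h; lra.
have : (1 + t) * f t <= (1 + e) * f e by exact: mul1D_density_nincr.
have : 0 <= t * f t by rewrite mulr_ge0.
by rewrite mulrDl mul1r; lra.
Qed.

(** A bounded density makes [F] Lipschitz. *)
Lemma distfun_continuous : continuous F.
Proof.
have [K K0 fK] := density_bounded.
have lip s t : s <= t -> F t - F s <= K * (t - s).
  move=> st; rewrite -lee_fin.
  have -> : (K * (t - s))%:E = (\int[lebesgue_measure]_(r in `]s, t]) K%:E)%E.
    rewrite (_ : \int[_]_(_ in _) _ = \int[lebesgue_measure]_(r in `]s, t]) cst K%:E r)%E//.
    rewrite integral_cst//= lebesgue_measure_itv/= lte_fin EFinM EFinB.
    by case: ltgtP st => // -> _; rewrite subee// mule0.
  by apply: (distfun_sub_le _ _ (fun=> K)) => // r _ _; exact: fK.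
move=> x; apply/cvgrPdist_lt => e e0; near=> y.
apply: (@le_lt_trans _ _ (K * `|x - y|)).
  have [xy|/ltW yx] := leP x y.
  - rewrite distrC ger0_norm ?subr_ge0 ?distfun_nondecreasing//.
    by rewrite distrC ger0_norm ?subr_ge0//; exact: lip.
  - rewrite ger0_norm ?subr_ge0 ?distfun_nondecreasing//.
    by rewrite ger0_norm ?subr_ge0//; exact: lip.
rewrite mulrC -ltr_pdivlMr//; near: y.
by apply: cvgr_dist_lt => //; rewrite divr_gt0.
Unshelve. all: by end_near. Qed.

Hypothesis Fy : F @ +oo --> (1 : R).

Lemma distfun_surj (q : R) : 0 <= q -> q < 1 -> exists2 t, 0 <= t & F t = q.
Proof.
move=> q0 q1.
have [T [T0 qT]] : exists T, 0 <= T /\ q < F T.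
  near (pinfty_nbhs R) => T; exists T; split; near: T; first exact: nbhs_pinfty_ge.
  by apply: (cvgr_gt _ Fy).
have cF : {within `[0, T], continuous F} by apply: continuous_subspaceT; exact: distfun_continuous.
have [|t] := @IVT _ F 0 T q T0 cF.
  by rewrite (distfun_le0 _ (lexx 0)) ge_min q0/= le_max (ltW qT) orbT.
by rewrite in_itv/= => /andP[t0 _] Ft; exists t.
Unshelve. all: by end_near. Qed.

End Cdf.

(** * The rate as an integral of tail probabilities *)

Lemma big_setIE (T : Type) (n : nat) (B : 'I_n -> set T) (w : T) :
  (\big[setI/setT]_(i < n) B i) w <-> forall i, B i w.
Proof.
rewrite -bigcap_seq; split=> h i; last by move=> _; exact: h.
by apply: h; rewrite /= mem_index_enum.
Qed.

Lemma ge0_integral_tail (R : realType) (d : measure_display)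
    (T : measurableType d) (P : probability T R) (Y : T -> R) :
  measurable_fun setT Y -> (forall w, 0 <= Y w) ->
  (\int[P]_w (Y w)%:E =
   \int[lebesgue_measure]_(u in `[0%R, +oo[) (1 - P [set w | (Y w <= u)%R]))%E.
Proof.
move=> mY Y0.
pose Z : {RV P >-> R} := HB.pack Y (isMeasurableFun.Build _ _ _ _ Y mY).
have := @ge0_expectation_ccdf _ _ _ P Z Y0; rewrite unlock => ->.
apply: eq_integral => u _; rewrite ccdf_1_cdf /cdf /distribution /pushforward/=.
congr (_ - P _)%E; apply/seteqP; split => w /=; by rewrite in_itv.
Qed.

Lemma measurable_sinr (R : realType) (d : measure_display)
    (T : measurableType d) (P : probability T R) (n M : nat) (rho : R)
    (X : 'I_n -> 'I_M -> {RV P >-> R}) (i : 'I_n) (m : 'I_M) : 0 < rho ->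
  measurable_fun setT (fun w => sinr rho (fun i' k => `|X i' k w| ^+ 2) i m).
Proof.
move=> rho0; rewrite /sinr.
have mX k : measurable_fun setT (fun w => `|X i k w| ^+ 2).
  by apply: measurable_funX; apply: measurableT_comp.
apply: measurable_funM => //.
have mS : measurable_fun setT (fun w => rho^-1 + \sum_(k < M | k != m) `|X i k w| ^+ 2).
  apply: measurable_funD => //; under eq_fun do rewrite -big_filter.
  exact: measurable_sum.
(* The noise term keeps the denominator positive, and inversion is continuous on the positive
   half-line. *)
apply: (@measurable_comp _ _ _ _ _ _ `](0 : R), +oo[%classic (fun x : R => x^-1)) => //.
  move=> _ [w _ <-] /=; rewrite in_itv/= andbT ltr_pwDl ?invr_gt0//.
  by apply: sumr_ge0 => k _; exact: exprn_ge0.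
apply: open_continuous_measurable_fun; first exact: interval_open.
move=> x; rewrite inE/= in_itv/= andbT => x0; apply: inv_continuous.
by rewrite gt_eqF.
Qed.

Lemma measurable_trunc_sinr (R : realType) (d : measure_display)
    (T : measurableType d) (g : T -> R) (tau : \bar R) :
  measurable_fun setT g -> measurable_fun setT (fun w => trunc_sinr (g w) tau).
Proof.
move=> mg; rewrite /trunc_sinr; case: tau => [r| |].
- by apply: measurable_fun_ifT => //; apply: measurable_fun_ler.
- by rewrite (_ : (fun w => _) = cst 0).
- by rewrite (_ : (fun w => _) = g)//; apply/funext => w; rewrite leNye.
Qed.

Lemma measurable_bigmax (R : realType) (d : measure_display)
    (T : measurableType d) (I : Type) (s : seq I) (h : I -> T -> R) :
  (forall i, measurable_fun setT (h i)) ->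
  measurable_fun setT (fun w => \big[Order.max/0]_(i <- s) h i w).
Proof.
move=> mh; elim: s => [|i s IH].
  by rewrite (_ : (fun w => _) = cst 0)//; apply/funext => w; rewrite big_nil.
rewrite (_ : (fun w => _) = fun w =>
    Num.max (h i w) (\big[Order.max/0]_(i <- s) h i w)); last first.
  by apply/funext => w; rewrite big_cons.
exact: measurable_maxr.
Qed.

Section Rate.
Context {R : realType} {d : measure_display} {T : measurableType d}.
Context (P : probability T R) (n M : nat) (gam : 'I_n -> 'I_M -> T -> R).
Context (F : R -> R).
Hypothesis mgam : forall i m, measurable_fun setT (gam i m).
Hypothesis gam_indep : users_independent P gam.
Hypothesis FE : forall i m x, P [set w | gam i m w <= x] = (F x)%:E.
Hypothesis Fincr : forall x y : R, 0 <= x -> x < y -> F x < F y.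
Hypothesis F1 : forall x, F x <= 1.
Hypothesis Fmono : forall x y : R, x <= y -> F x <= F y.
Hypothesis Fsurj : forall q : R, 0 <= q -> q < 1 -> exists2 t, 0 <= t & F t = q.

(** For [t >= 0] this is the event that the report is at most [t]: the SINR is small or the user is
    silent. The two alternatives are nested half-lines, so the larger probability wins. *)
Lemma prob_trunc_sinr_le (i : 'I_n) (m : 'I_M) (q t : R) : 0 <= q <= 1 ->
  P (gam i m @^-1` [set x | x <= t \/ (x%:E < Finv F q)%E]) =
  (Num.max (F t) q)%:E.
Proof.
move=> /andP[q0 q1]; have [->|nq1] := eqVneq q 1.
  rewrite (max_idPr _)// -[RHS](probability_setT P); congr (P _).
  apply/seteqP; split=> // w _; right.
  (* [F] never reaches [1], so the threshold for [q = 1] is [+oo]. *)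
  rewrite /Finv (_ : [set t | _] = set0) ?image_set0 ?ereal_inf0 ?ltry//.
  apply/seteqP; split=> // x [x0 Fx].
  have : F x < 1 by apply: lt_le_trans (F1 (x + 1)); apply: Fincr; rewrite ?ltrDl.
  by rewrite ltNge Fx.
have /Fsurj[//|tau tau0 Ftau] : q < 1 by rewrite lt_neqAle nq1.
rewrite -Ftau Finv_incr//.
have [taut|ttau] := leP tau t.
  rewrite (max_idPl _) ?Fmono// -(FE i m t); congr (P _).
  apply/seteqP; split=> w /=; rewrite ?lte_fin; last by left.
  by case=> // /ltW h; exact: le_trans taut.
rewrite (max_idPr _); last by rewrite Fmono// ltW.
have -> : gam i m @^-1` [set x | x <= t \/ (x%:E < tau%:E)%E] = [set w | gam i m w < tau].
  apply/seteqP; split=> w /=; rewrite ?lte_fin; last by right.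
  by case=> // h; exact: le_lt_trans ttau.
have mlt : measurable [set w | gam i m w < tau].
  rewrite (_ : [set w | _] = setT `&` gam i m @^-1` `]-oo, tau[%classic).
    by apply: mgam.
  by apply/seteqP; split => [w|w []]; rewrite /= in_itv.

have mle s : measurable [set w | gam i m w <= s].
  rewrite (_ : [set w | _] = setT `&` gam i m @^-1` `]-oo, s]%classic).
    by apply: mgam.
  by apply/seteqP; split => [w|w []]; rewrite /= in_itv.

apply/eqP; rewrite eq_le; apply/andP; split.
  rewrite -(FE i m tau); apply: le_measure; rewrite ?inE//.
  by move=> w /=; exact: ltW.
(* There is no atom at [tau]: otherwise a value of [F] halfway between [y] and [F tau] is attained
   at some [s < tau], yet [F s <= y]. *)
have : (P [set w | gam i m w < tau] \is a fin_num) by exact: fin_num_measure.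
rewrite leNgt => /fineK yE; apply/negP; rewrite -yE lte_fin; set y := fine _ => yF.
have y0 : 0 <= y by apply: fine_ge0.
have [//||s s0 Fs] := @Fsurj ((y + F tau) / 2).
- by rewrite divr_ge0// addr_ge0// Ftau.
- by have := F1 tau; lra.
have st : s < tau.
  by rewrite ltNge; apply/negP => /Fmono; rewrite Fs; lra.
have : (F s <= y)%R.
  rewrite -lee_fin yE -(FE i m s); apply: le_measure; rewrite ?inE//.
  by move=> w /= h; exact: le_lt_trans st.
by rewrite Fs; lra.
Qed.

Lemma prob_max_trunc_sinr_le (m : 'I_M) (p : 'I_n -> R) (u : R) :
  unit_cube p -> 0 <= u ->
  P [set w | ln (1 + \big[Order.max/0]_(i < n)
       trunc_sinr (gam i m w) (thresholds F p i)) <= u] =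
  (\prod_(i < n) Num.max (F (expR u - 1)) (1 - p i))%:E.
Proof.
move=> cp u0; set t := expR u - 1.
have t0 : 0 <= t by rewrite subr_ge0 -expR0 ler_expR.
(* Taking the whole line on every other beam reduces independence of the user vectors to beam
   [m]. *)
pose A (i : 'I_n) (k : 'I_M) : set R :=
  if k == m then [set x | x <= t \/ (x%:E < thresholds F p i)%E] else setT.
have mA i k : measurable (A i k).
  rewrite /A; case: ifP => // _.
  rewrite (_ : [set x | _] = `]-oo, t]%classic `|`
      [set x | (x%:E < thresholds F p i)%E]); last first.
    by apply/seteqP; split=> x /=; rewrite in_itv.
  apply: measurableU; first exact: measurable_itv.
  case: (thresholds F p i) => [r| |].
  - rewrite (_ : [set x | _] = `]-oo, r[%classic); first exact: measurable_itv.
    by apply/seteqP; split=> x /=; rewrite in_itv/= lte_fin.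
  - rewrite (_ : [set x | _] = setT)//.
    by apply/seteqP; split=> x //= _; exact: ltry.
  - rewrite (_ : [set x | _] = set0)//.
    by apply/seteqP; split=> x //=.
have AE i : \big[setI/setT]_(k < M) (gam i k @^-1` A i k) =
    gam i m @^-1` [set x | x <= t \/ (x%:E < thresholds F p i)%E].
  rewrite (bigD1 m)//= big1 => [|k km]; last by rewrite /A (negbTE km) preimage_setT.
  by rewrite setIT /A eqxx.
have lnle w : (ln (1 + \big[Order.max/0]_(i < n)
       trunc_sinr (gam i m w) (thresholds F p i)) <= u) =
    (\big[Order.max/0]_(i < n) trunc_sinr (gam i m w) (thresholds F p i) <= t).
  set y := \big[Order.max/0]_(i < n) _.
  have y0 : 0 <= y by exact: bigmax_ge_id.
  have y1 : 0 < 1 + y by rewrite ltr_pwDl.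
  by rewrite -ler_expR lnK ?posrE// /t lerBrDl.
transitivity (P (\big[setI/setT]_(i < n) \big[setI/setT]_(k < M) (gam i k @^-1` A i k))).
  congr (P _); apply/seteqP; split=> w /=; rewrite lnle big_setIE.
  - move=> h i; rewrite AE /=.
    have : trunc_sinr (gam i m w) (thresholds F p i) <= t.
      by apply: le_trans h; exact: le_bigmax.
    by rewrite /trunc_sinr; case: leP => [_|]; [left|right].
  (* A silent user reports [0], which is at most [t] since [u >= 0]. *)
  - move=> h; apply: bigmax_le => // i _; have := h i; rewrite AE /=.
    rewrite /trunc_sinr; case: ifP => // tg [//|].
    by rewrite ltNge tg.
rewrite gam_indep//; under eq_bigr do rewrite AE.
rewrite -prodEFin; apply: eq_bigr => i _; apply: prob_trunc_sinr_le.
by have := cp i; move=> /andP[? ?]; lra.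
Qed.

(** Linearity of expectation separates the beams, which may be dependent within a user; the
    layer-cake formula then treats each one. *)
Lemma sum_rateE (p : 'I_n -> R) : unit_cube p ->
  sum_rate P gam F p =
  (\sum_(m < M) \int[lebesgue_measure]_(u in `[0%R, +oo[)
    (1 - \prod_(i < n) Num.max (F (expR u - 1)) (1 - p i))%:E)%E.
Proof.
move=> cp; rewrite /sum_rate; under eq_integral do rewrite -sumEFin.
pose Y (m : 'I_M) w : R := ln (1 + \big[Order.max/0]_(i < n)
                 trunc_sinr (gam i m w) (thresholds F p i)).
have mY m : measurable_fun setT (Y m).
  apply: measurableT_comp => //; apply: measurable_funD => //.
  by apply: measurable_bigmax => i; exact: measurable_trunc_sinr.
have Y0 m w : 0 <= Y m w by rewrite ln_ge0// lerDl bigmax_ge_id.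
rewrite (@ge0_integral_sum _ _ _ P _ measurableT _ (fun m w => (Y m w)%:E)).
- apply: eq_bigr => m _; rewrite ge0_integral_tail//.
  apply: eq_integral => u; rewrite inE/= in_itv/= andbT => u0.
  by rewrite prob_max_trunc_sinr_le.
- by move=> m; apply/measurable_EFinP.
- by move=> m w _; rewrite lee_fin.
Qed.

End Rate.

(** * The sum rate under a transfer *)

Lemma big_transfer (R : realType) (n : nat) (x : 'I_n -> R) (j k : 'I_n)
    (e : R) (g : R -> R) : j != k ->
  \prod_i g (transfer x j k e i) =
  (\prod_(i | (i != k) && (i != j)) g (x i)) * (g (x k + e) * g (x j - e)).
Proof.
move=> jk; rewrite (bigD1 k)//= (bigD1 j)//= mulrC -mulrA mulrC mulrA.
rewrite (eq_bigr (fun i => g (x i))) => [|i /andP[ik ij]]; last first.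
  by rewrite /transfer (negbTE ij) (negbTE ik).
rewrite {1 2}/transfer eqxx [k == j]eq_sym (negbTE jk) eqxx.
by ring.
Qed.

Lemma transfer0 (R : realType) (n : nat) (x : 'I_n -> R) (j k : 'I_n) :
  transfer x j k 0 = x.
Proof.
by apply/funext => i; rewrite /transfer subr0 addr0; do 2!case: eqP => [->|_] //.
Qed.

Theorem theorem1 (R : realType) (d : measure_display) (T : measurableType d)
  (P : probability T R) (n M : nat) (rho : R)
  (X : 'I_n -> 'I_M -> {RV P >-> R}) (F f : R -> R) :
  (2 <= n)%N -> (1 <= M)%N -> 0 < rho ->
  let gam : 'I_n -> 'I_M -> T -> R :=
    fun i m w => sinr rho (fun i' k => `|X i' k w| ^+ 2) i m in
  users_independent P gam ->
  users_ident_distr P gam ->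
  (* common marginal distribution function F *)
  (forall i m x, P [set w | gam i m w <= x] = (F x)%:E) ->
  (* f is a density of F *)
  measurable_fun setT f ->
  (forall t, 0 <= f t) ->
  (forall x, (F x)%:E = (\int[lebesgue_measure]_(t in `]-oo, x]) (f t)%:E)%E) ->
  (* the support is [0, oo) *)
  (forall t, t < 0 -> f t = 0) ->
  (forall x y, 0 <= x -> x < y -> F x < F y) ->
  (* f bounded in a neighbourhood of 0 *)
  (exists delta C : R, 0 < delta /\ forall t, `|t| < delta -> `|f t| <= C) ->
  (* f differentiable on (0, oo) *)
  (forall t, 0 < t -> derivable f t 1) ->
  (forall x, 0 < x < 1 ->
     derive1 f (fine (Finv F x)) <= - f (fine (Finv F x)) / (1 + fine (Finv F x))) ->
  schur_concave_on (@unit_cube R n) (sum_rate P gam F).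
Proof.
move=> n2 M1 rho0 gam indep _ FP mf f0 FE fN Fincr fbd df ddf.
have mgam i m : measurable_fun setT (gam i m) by exact: measurable_sinr.
pose i0 : 'I_n := Ordinal (ltnW n2); pose m0 : 'I_M := Ordinal M1.
have F1 x : F x <= 1.
  rewrite -lee_fin -(FP i0 m0); apply: probability_le1.
  rewrite (_ : [set w | _] = setT `&` gam i0 m0 @^-1` `]-oo, x]%classic).
    by apply: mgam.
  by apply/seteqP; split => [w|w []]; rewrite /= in_itv.
have Fy : F @ +oo --> (1 : R).
  pose Z : {RV P >-> R} :=
    HB.pack (gam i0 m0) (isMeasurableFun.Build _ _ _ _ (gam i0 m0) (mgam i0 m0)).
  have ZF : EFin \o F = cdf Z.
    apply/funext => x /=; rewrite -(FP i0 m0) /cdf /distribution /pushforward/=.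
    by congr (P _); apply/seteqP; split => w /=; rewrite in_itv.
  by have := @cvg_cdfy1 _ _ _ P Z; rewrite -ZF => /fine_cvg.
have Fmono (x y : R) : x <= y -> F x <= F y by exact: (distfun_nondecreasing _ _ mf f0 FE).
have F0 (x : R) : x <= 0 -> F x = 0 by exact: (distfun_le0 _ _ mf FE fN).
have Fge0 x : 0 <= F x by rewrite -lee_fin -(FP i0 m0).
have Fsurj (q : R) : 0 <= q -> q < 1 -> exists2 t, 0 <= t & F t = q.
  exact: (distfun_surj _ _ mf f0 FE fN F1 Fincr df ddf fbd Fy).
have Fray (s t : R) : 0 <= s -> s <= t -> F t * ln (1 + s) <= F s * ln (1 + t).
  exact: (distfun_ray_ln _ _ mf f0 FE fN F1 Fincr df ddf).
pose H u := F (expR u - 1).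
(* [psi] agrees with the rate on the cube and is symmetric for arbitrary vectors, as
   [schur_concave_transfer] demands. *)
pose psi (p : 'I_n -> R) : \bar R := (\sum_(m < M)
  \int[lebesgue_measure]_(u in `[0%R, +oo[)
    (1 - \prod_(i < n) Num.max (H u) (1 - p i))%:E)%E.
have rateE p : unit_cube p -> sum_rate P gam F p = psi p.
  exact: (sum_rateE _ _ _ _ _ mgam indep FP Fincr F1 Fmono Fsurj).
suff : schur_concave_on (@unit_cube R n) psi.
  by move=> sc x y cx cy xy; rewrite !rateE//; exact: sc.
have prodE (x : 'I_n -> R) (h : R) : \prod_(i < n) Num.max h (1 - x i) =
    \prod_(a <- [seq x i | i <- enum 'I_n]) Num.max h (1 - a).
  by rewrite big_map big_enum.
apply: schur_concave_transfer => [x j k e cx jk|x y xy]; last first.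
  apply: eq_bigr => m _; apply: eq_integral => u _; rewrite !prodE.
  by rewrite (perm_big _ xy).
(* For [e > 0] the number [1 - (x k + e)], which plays [a'], lies strictly between [0] and [1], so
   it is [F t] for some [t > 0]. *)
rewrite le_eqVlt => /predU1P[<-|e0 xkj]; first by rewrite transfer0.
have /andP[xk0 xk1] := cx k; have /andP[xj0 xj1] := cx j.
have [|//|t t0 Ft] := Fsurj (1 - (x k + e)); [lra|lra|].
have {}t0 : 0 < t.
  rewrite lt_neqAle t0 andbT; apply: contra_eq_neq Ft => <-.
  by rewrite F0// lt_eqF//; lra.
pose c h := \prod_(i | (i != k) && (i != j)) Num.max h (1 - x i).
have max0 h (i : 'I_n) : 0 <= Num.max h (1 - x i).
  by rewrite le_max subr_ge0; have /andP[_ ->] := cx i; rewrite orbT.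
have cE u e' : \prod_i Num.max (H u) (1 - transfer x j k e' i) =
    c (H u) * maxmul (1 - (x k + e')) (1 - (x j - e')) (H u).
  exact: (big_transfer _ _ _ _ _ _ (fun y => Num.max (H u) (1 - y)) jk).
(* Reading [x] as the transfer of amount [0] lets [cE] factor both sides alike. *)
rewrite -{1}(transfer0 _ _ x j k).
apply: lee_sum => m _; under eq_integral do rewrite cE.
under [leRHS]eq_integral do rewrite cE.
apply: (@integral_one_sub_maxmul_le _ _ _ _ _ _ _ (ln (1 + t))); try lra.
- apply: nondecreasing_measurable => // s u su.
  by apply: Fmono; rewrite lerD2r ler_expR.
- by move=> u u0; rewrite Fge0 F1.
- by move=> s u _ su; apply: Fmono; rewrite lerD2r ler_expR.
- move=> s u s0 su.
  have e1 (r : R) : 1 + (expR r - 1) = expR r by rewrite addrC subrK.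
  have := Fray (expR s - 1) (expR u - 1); rewrite !e1 !expRK; apply.
  + by rewrite subr_ge0 -expR0 ler_expR.
  + by rewrite lerD2r ler_expR.
- move=> s u su; apply: ler_prod => i _; rewrite max0/=.
  by rewrite ge_max !le_max su lexx orbT.
- move=> h /andP[h0 h1]; rewrite prodr_ge0//=; apply: prodr_ile1 => i _.
  by rewrite max0 ge_max h1 gerBl; have /andP[] := cx i.
- by rewrite ln_gt0// ltrDl.
- by rewrite /H lnK ?posrE ?addr_gt0// addrAC subrr add0r.
Qed.
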